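(* Let $0\le q_1\le n_1$ and $0\le q_2\le n_2$ be integers and let $\{x_i\}_{i=q_1}^{n_1}$ and $\{y_i\}_{i=q_2}^{n_2}$ be unimodal sequences of nonnegative numbers. Let $l_1,l_1+1,\dots,m_1$ be the modes of $\{x_i\}$ and $l_2,l_2+1,\dots,m_2$ be the modes of $\{y_i\}$ (with $l_1\le m_1$, $l_2\le m_2$). Let $r_1,r_2$ be non-negative integers and let $a_1,a_2>0$. Then the sequence $\{a_1x_{i-r_1}+a_2y_{i-r_2}\}_i$ is unimodal if and only if its restriction to the indices $i$ with $\min\{l_1+r_1,\,l_2+r_2\}\le i\le \max\{m_1+r_1,\,m_2+r_2\}$ is unimodal.
   Context: A finite sequence of nonnegative numbers $\{a_i\}_{i=q}^{n}$ ($0\le q\le n$) is unimodal if there are indices $q\le l\le m\le n$ with $a_q\le a_{q+1}\le\cdots\le a_{l-1}<a_l=\cdots=a_m>a_{m+1}\ge\cdots\ge a_n$ (inequalities involving indices outside $[q,n]$ are omitted). The indices $l,l+1,\dots,m$ are called the modes of the sequence. Terms $x_i$, $y_i$ with index outside the given ranges are taken to be $0$, and the combined sequence $\{a_1x_{i-r_1}+a_2y_{i-r_2}\}$ is indexed by $\min_{j=1,2}\{q_j+r_j\}\le i\le \max_{j=1,2}\{n_j+r_j\}$. *)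

(* Defs.v *)
From mathcomp Require Import all_boot all_order all_algebra.

Set Implicit Arguments.
Unset Strict Implicit.
Unset Printing Implicit Defensive.

Import Order.TTheory GRing.Theory Num.Theory.
Local Open Scope ring_scope.

(* A finite sequence {a_i}_{i=q}^n is a function a : nat -> R together with
   its index bounds q and n; the predicates below read a only on [q, n]. *)

Definition nonneg_on (R : realFieldType) (q n : nat) (a : nat -> R) : Prop :=
  forall i : nat, (q <= i <= n)%N -> 0 <= a i.

(* l, ..., m are the modes of {a_i}_{i=q}^n:
   a_q <= ... <= a_(l-1) < a_l = ... = a_m > a_(m+1) >= ... >= a_n,
   where the inequalities involving an index outside [q, n] are omitted. *)
Definition has_modes (R : realFieldType) (q n : nat) (a : nat -> R)
    (l m : nat) : Prop :=
  [/\ (q <= l)%N, (l <= m)%N & (m <= n)%N] /\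
  [/\ forall i : nat, (q <= i)%N -> (i.+1 <= l.-1)%N -> a i <= a i.+1,
      (q < l)%N -> a l.-1 < a l,
      forall i : nat, (l <= i)%N -> (i < m)%N -> a i = a i.+1,
      (m < n)%N -> a m > a m.+1 &
      forall i : nat, (m.+1 <= i)%N -> (i < n)%N -> a i >= a i.+1].

Definition unimodal (R : realFieldType) (q n : nat) (a : nat -> R) : Prop :=
  exists l m : nat, has_modes q n a l m.

(* The term x_(i-r) of {x_i}_{i=q}^n, which is 0 when the integer i - r is
   outside [q, n]. The test is on q + r <= i <= n + r because the subtraction
   of nat is truncated: for i < r and q = 0 it would wrongly give x_0. *)
Definition shifted (R : realFieldType) (q n : nat) (x : nat -> R) (r i : nat)
    : R :=
  if (q + r <= i <= n + r)%N then x (i - r)%N else 0.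

(* Main.v *)
(* Unimodality is equivalent to the existence of a peak: an index up to which
   the sequence is nondecreasing and from which on it is nonincreasing. Extended
   by zero, each shifted summand is nondecreasing up to its first mode and
   nonincreasing from its last mode on, hence the combined sequence z is
   nondecreasing before min (l_j + r_j) and nonincreasing after
   max (m_j + r_j). A peak of the restriction of z is thus a peak of z, and a
   peak of z, clamped to the restricted range, is a peak of the restriction. *)
Require Import Defs.
From mathcomp Require Import all_boot all_order all_algebra.
From mathcomp Require Import zify.

Set Implicit Arguments.
Unset Strict Implicit.
Unset Printing Implicit Defensive.

Import Order.TTheory GRing.Theory Num.Theory.
Local Open Scope ring_scope.

(** Only weak inequalities occur, so any index of a top plateau qualifies and no strict jump has to
    be tracked when the range changes. *)
Definition peak (R : realFieldType) (q n : nat) (a : nat -> R) (p : nat) :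
    Prop :=
  [/\ (q <= p <= n)%N,
      forall i : nat, (q <= i < p)%N -> a i <= a i.+1 &
      forall i : nat, (p <= i < n)%N -> a i.+1 <= a i].

(** Every mode is a peak, not just one of them: the first mode serves for the rise and the last one
    for the fall. *)
Lemma has_modes_peak (R : realFieldType) (q n : nat) (a : nat -> R)
    (l m : nat) :
  has_modes q n a l m ->
  forall p : nat, (l <= p <= m)%N -> peak q n a p.
Proof.
move=> [[ql lm mn] [incr lt_l eq_lm gt_m decr]] p /andP[lp pm].
split=> [|i /andP[qi ip]|i /andP[pi i_n]]; first by lia.
- have [li|il] := leqP l i; first by rewrite (eq_lm i) //; lia.
  have [il1|li1] := leqP i.+1 l.-1; first exact: incr.
  have -> : i.+1 = l by lia.
  have -> : i = l.-1 by lia.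
  by apply/ltW/lt_l; lia.
- have [im|mi] := ltnP i m; first by rewrite (eq_lm i) //; lia.
  move: mi; rewrite leq_eqVlt => /orP[/eqP mi|mi]; last exact: decr.
  by move: gt_m; rewrite mi => gt_m; apply/ltW/gt_m.
Qed.

Lemma peak_nondecreasing (R : realFieldType) (q n : nat) (a : nat -> R)
    (p i j : nat) :
  peak q n a p -> (q <= i)%N -> (i <= j <= p)%N -> a i <= a j.
Proof.
move=> [_ incr _] qi /andP[ij]; rewrite -(subnKC ij).
elim: (j - i)%N => [|k IHk] kp; first by rewrite addn0.
rewrite addnS in kp *.
by apply: le_trans (IHk (ltnW kp)) (incr _ _); lia.
Qed.

Lemma peak_nonincreasing (R : realFieldType) (q n : nat) (a : nat -> R)
    (p i j : nat) :
  peak q n a p -> (p <= i)%N -> (i <= j <= n)%N -> a j <= a i.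
Proof.
move=> [_ _ decr] pi /andP[ij]; rewrite -(subnKC ij).
elim: (j - i)%N => [|k IHk] kn; first by rewrite addn0.
rewrite addnS in kn *.
by apply: le_trans (decr _ _) (IHk (ltnW kn)); lia.
Qed.

(** The modes are recovered as the first and last indices of the range at which the value [a p] is
    attained; their extremality makes the inequalities at both ends strict. *)
Lemma peak_unimodal (R : realFieldType) (q n : nat) (a : nat -> R) (p : nat) :
  peak q n a p -> unimodal q n a.
Proof.
move=> pk; have [/andP[qp pn] incr decr] := pk.
have exl : exists i, (q <= i)%N && (a i == a p).
  by exists p; rewrite qp eqxx.
have exm : exists i, (i <= n)%N && (a i == a p).
  by exists p; rewrite pn eqxx.
have ubm i : (i <= n)%N && (a i == a p) -> (i <= n)%N by case/andP.
case: (ex_minnP exl) => l /andP[ql /eqP al] minl.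
case: (ex_maxnP exm ubm) => m /andP[mn /eqP am] maxm.
have lp : (l <= p)%N by apply: minl; rewrite qp eqxx.
have pm : (p <= m)%N by apply: maxm; rewrite pn eqxx.
(* Monotonicity on each side of [p] squeezes [a i] between [a p] and [a l] or [a m], which all
   agree. *)
have const i : (l <= i <= m)%N -> a i = a p.
  move=> /andP[li im]; apply/le_anti; case: (leqP i p) => ip.
    rewrite (peak_nondecreasing pk) /=; try by lia.
    by rewrite -al (peak_nondecreasing pk) //; lia.
  rewrite (peak_nonincreasing pk) /=; try by lia.
  by rewrite -am (peak_nonincreasing pk) //; lia.
exists l, m; split; split=> //.
- exact: leq_trans pm.
- by move=> i qi il; apply: incr; lia.
- move=> ltql; rewrite lt_neqAle (peak_nondecreasing pk) ?andbT; try by lia.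
  (* Equality would make [l.-1] a smaller index with value [a p]. *)
  apply/eqP => eql; have := minl l.-1; rewrite eql al eqxx andbT; lia.
- by move=> i li im; rewrite !const //; lia.
- move=> ltmn; rewrite lt_neqAle (peak_nonincreasing pk) ?andbT; try by lia.
  apply/eqP => eqm; have := maxm m.+1; rewrite eqm am eqxx andbT; lia.
- by move=> i mi i_n; apply: decr; lia.
Qed.

Lemma unimodalP (R : realFieldType) (q n : nat) (a : nat -> R) :
  unimodal q n a <-> exists p : nat, peak q n a p.
Proof.
split=> [[l [m lm]]|[p]]; last exact: peak_unimodal.
exists l; apply: (has_modes_peak lm).
by have [[_ -> _] _] := lm; rewrite leqnn.
Qed.

Lemma unimodal_restrict (R : realFieldType) (q n l m : nat) (a : nat -> R) :
  (q <= l)%N -> (l <= m)%N -> (m <= n)%N ->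
  (forall i : nat, (i < l)%N -> a i <= a i.+1) ->
  (forall i : nat, (m <= i)%N -> a i.+1 <= a i) ->
  unimodal q n a <-> unimodal l m a.
Proof.
move=> ql lm mn incr_l decr_m; rewrite !unimodalP.
split=> [] [p [/andP[lo hi] incr decr]].
  (* Clamping [p] to [[l, m]]: if [p < l] the restriction only falls, so [l] is a peak; if [p > m]
     it only rises, so [m] is one. *)
  exists (maxn l (minn p m)); split=> [|i ip|i ip]; first by lia.
    by apply: incr; lia.
  by apply: decr; lia.
exists p; split=> [|i ip|i ip]; first by lia.
  by have [il|li] := ltnP i l; [exact: incr_l|apply: incr; lia].
by have [mi|im] := leqP m i; [exact: decr_m|apply: decr; lia].
Qed.

Lemma shifted_nondecreasing (R : realFieldType) (q n : nat) (x : nat -> R)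
    (p r i : nat) :
  nonneg_on q n x -> peak q n x p -> (i < p + r)%N ->
  shifted q n x r i <= shifted q n x r i.+1.
Proof.
move=> x_ge0 [/andP[qp pn] incr _] ip.
have [qi|iq] := leqP (q + r) i; rewrite /shifted.
  have -> : (q + r <= i <= n + r)%N by lia.
  have -> : (q + r <= i.+1 <= n + r)%N by lia.
  by rewrite subSn; [apply: incr|]; lia.
(* Before the support the left term is 0, and the right one is 0 or, on entering the support, [x q];
   nonnegativity settles both. *)
rewrite ifF; last by lia.
  by case: ifP => // ?; apply: x_ge0; lia.
Qed.

Lemma shifted_nonincreasing (R : realFieldType) (q n : nat) (x : nat -> R)
    (p r i : nat) :
  nonneg_on q n x -> peak q n x p -> (p + r <= i)%N ->
  shifted q n x r i.+1 <= shifted q n x r i.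
Proof.
move=> x_ge0 [/andP[qp pn] _ decr] pi.
have [i_n|ni] := ltnP i (n + r); rewrite /shifted.
  have -> : (q + r <= i <= n + r)%N by lia.
  have -> : (q + r <= i.+1 <= n + r)%N by lia.
  by rewrite subSn; [apply: decr|]; lia.
(* Here the term at [i.+1] is past the support, while the one at [i] is 0 or [x n]. *)
rewrite ifF; last by lia.
  by case: ifP => // ?; apply: x_ge0; lia.
Qed.

Theorem theorem2p1 (R : realFieldType)
    (q1 n1 q2 n2 : nat) (hq1 : (q1 <= n1)%N) (hq2 : (q2 <= n2)%N)
    (x y : nat -> R)
    (x_ge0 : nonneg_on q1 n1 x) (y_ge0 : nonneg_on q2 n2 y)
    (x_unimodal : unimodal q1 n1 x) (y_unimodal : unimodal q2 n2 y)
    (l1 m1 l2 m2 : nat)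
    (x_modes : has_modes q1 n1 x l1 m1) (y_modes : has_modes q2 n2 y l2 m2)
    (r1 r2 : nat) (a1 a2 : R) (a1_gt0 : 0 < a1) (a2_gt0 : 0 < a2) :
  let z := fun i : nat => a1 * shifted q1 n1 x r1 i + a2 * shifted q2 n2 y r2 i in
  unimodal (minn (q1 + r1) (q2 + r2)) (maxn (n1 + r1) (n2 + r2)) z <->
  unimodal (minn (l1 + r1) (l2 + r2)) (maxn (m1 + r1) (m2 + r2)) z.
Proof.
move=> z.
have [[ql1 lm1 mn1] _] := x_modes; have [[ql2 lm2 mn2] _] := y_modes.
have peak_x := has_modes_peak x_modes; have peak_y := has_modes_peak y_modes.
apply: unimodal_restrict; try by lia.
(* An index below the minimum lies below both [l1 + r1] and [l2 + r2], so both summands rise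
   there. *)
- move=> i il; apply: lerD; rewrite ler_pM2l //.
    by apply: (shifted_nondecreasing (p := l1)) => //; [apply: peak_x|]; lia.
  by apply: (shifted_nondecreasing (p := l2)) => //; [apply: peak_y|]; lia.
- move=> i mi; apply: lerD; rewrite ler_pM2l //.
    by apply: (shifted_nonincreasing (p := m1)) => //; [apply: peak_x|]; lia.
  by apply: (shifted_nonincreasing (p := m2)) => //; [apply: peak_y|]; lia.
Qed.
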